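(* Let $X$ be a commutative topological free algebra over $\mathbb{K}$ having a set of free generators of infinite cardinality $\alpha$, and suppose $w(X)\le\alpha$. Then there is a family $\{Y_\kappa\}_{\kappa<\alpha}$ of subalgebras of $X$ such that: (1) each $Y_\kappa$ is a dense subalgebra of $X$ of the form $Y_\kappa=\langle F_\kappa\rangle$ with $F_\kappa$ a set of free generators of cardinality $\alpha$; (2) the family is algebraically independent, i.e., the $F_\kappa$ can be chosen pairwise disjoint with $\bigcup_{\kappa<\alpha}F_\kappa$ a set of free generators (in particular $Y_{\kappa_1}\cap Y_{\kappa_2}=\{0\}$ for $\kappa_1\neq\kappa_2$).
   Context: Algebras are associative linear algebras over $\mathbb{K}$ ($\mathbb{R}$ or $\mathbb{C}$); a topological algebra is an algebra with a topology making sum, product and scalar multiplication continuous. $w(X)$ is the smallest cardinality of a base of the topology. $\langle S\rangle$ denotes the subalgebra generated by $S$. With $\mathbb{P}_n$ the polynomials in $n$ variables without constant term, a subset $S$ of a commutative algebra is a set of free generators (SFG) if $P(x_1,\dots,x_n)\ne0$ for every $n$, every non-zero $P\in\mathbb{P}_n$ and all pairwise distinct $x_1,\dots,x_n\in S$. A commutative free algebra is one of the form $X=\langle A\rangle$ with $A$ an SFG; it is $\alpha$-generated free when such $A$ has cardinality $\alpha$. *)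

(* Defs.v *)
From HB Require Import structures.
From mathcomp Require Import all_boot all_order all_algebra.
From mathcomp Require Import mpoly.
From mathcomp Require Import boolp classical_sets functions cardinality reals.
From mathcomp Require Import topology num_normedtype tvs.
From mathcomp Require Import complex.

Set Implicit Arguments.
Unset Strict Implicit.
Unset Printing Implicit Defensive.

Import Order.TTheory GRing.Theory Num.Theory.
Import numFieldTopology.Exports.

Local Open Scope classical_set_scope.
Local Open Scope ring_scope.

Definition Kfield (R : realType) (b : bool) : numFieldType :=
  if b then (R[i])%C : numFieldType else R : numFieldType.

Section TopAlg.
Variable K : numFieldType.
Variable X : topologicalLmodType K.
Variable mul : X -> X -> X.

(* mul makes X a commutative (associative, not necessarily unital)
   topological K-algebra: X is already a topological vector space
   (continuous sum and scalar multiplication); the product is associative,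
   commutative, bilinear and jointly continuous. *)
Definition comm_top_algebra : Prop :=
  [/\ forall x y z, mul x (mul y z) = mul (mul x y) z,
      forall x y, mul x y = mul y x,
      forall x y z, mul (x + y) z = mul x z + mul y z,
      forall (a : K) x y, mul (a *: x) y = a *: mul x y &
      continuous (fun p : X * X => mul p.1 p.2)].

Definition nprod (s : seq X) : X :=
  if s is x :: s' then foldl mul x s' else 0.

(* Value of the monomial x^m = prod_i x_i^(m_i) (for m <> 0). *)
Definition mono_eval (n : nat) (x : 'I_n -> X) (m : mpoly.multinom n) : X :=
  nprod (flatten [seq nseq (tnth (mpoly.multinom_val m) i) (x i) | i <- enum 'I_n]).

Definition peval (n : nat) (P : mpoly.mpoly n K) (x : 'I_n -> X) : X :=
  \sum_(m <- mpoly.msupp P) mpoly.mcoeff m P *: mono_eval x m.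

Definition no_const_term (n : nat) (P : mpoly.mpoly n K) : Prop :=
  mpoly.mcoeff (@mpoly.mnm0 n) P = 0.

Definition SFG (S : set X) : Prop :=
  forall (n : nat) (P : mpoly.mpoly n K) (x : 'I_n -> X),
    no_const_term P -> P <> 0 -> injective x -> (forall i, S (x i)) ->
    peval P x <> 0.

Definition subalgebra (T : set X) : Prop :=
  [/\ T 0,
      forall x y, T x -> T y -> T (x + y),
      forall (a : K) x, T x -> T (a *: x) &
      forall x y, T x -> T y -> T (mul x y)].

Definition gen_subalg (S : set X) : set X :=
  \bigcap_(T in [set T | subalgebra T /\ S `<=` T]) T.

End TopAlg.

Definition is_base (T : topologicalType) (B : set (set T)) : Prop :=
  B `<=` open /\
  forall U : set T, open U -> forall x, U x -> exists2 V, B V & V x /\ V `<=` U.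

(* Main.v *)
Require Import Defs.
From HB Require Import structures.
From mathcomp Require Import all_boot all_order all_algebra.
From mathcomp Require Import mpoly.
From mathcomp Require Import boolp classical_sets functions cardinality reals.
From mathcomp Require Import topology num_normedtype tvs.
From mathcomp Require Import complex.
Import Order.TTheory GRing.Theory Num.Theory.
Import numFieldTopology.Exports.

(** Since [A `*` A] injects into [A], each pair (k, a) of generators can be
given its own generator [c (k, a)]. If [a] codes the basic open set V, choose
v in V, a polynomial in the generators, and put
  f (k, a) = v + e * c (k, a)^N
with N above the degree of v and e <> 0 so small that f (k, a) is still in V.
The leading monomial of f (k, a) is [c (k, a)^N], so the elements f (k, a) are
algebraically independent, whatever generators occur in the v's. Hence
F k = {f (k, a) | a in A} works. *)

Set Implicit Arguments.
Unset Strict Implicit.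
Unset Printing Implicit Defensive.

Local Open Scope classical_set_scope.
Local Open Scope card_scope.

(** * Cardinal arithmetic: comparability, and absorption of squares by infinite sets *)

Lemma card_le_funP T (U : pointedType) (A : set T) (B : set U) :
  A #<= B <-> exists2 f : T -> U, (forall x, A x -> B (f x)) &
    forall x y, A x -> A y -> f x = f y -> x = y.
Proof.
split=> [/pcard_leP/injfunPex[f fAB fI]|[f fAB fI]].
  by exists f => // x y Ax Ay; apply: fI; rewrite inE.
apply/pcard_leP/injfunPex; exists f => // x y.
by rewrite !inE; apply: fI.
Qed.

(** Converts the graphs produced by Zorn's lemma into injections: choice selects one image for each
    point, so [G] need not be functional. *)
Lemma card_le_rel T (U : pointedType) (A : set T) (B : set U)
    (G : T -> U -> Prop) :
  (forall x, A x -> exists2 y, B y & G x y) ->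
  (forall x x' y, G x y -> G x' y -> x = x') -> A #<= B.
Proof.
move=> GAB Ginj.
have /choice[f fP] : forall x, exists y, A x -> B y /\ G x y.
  move=> x; have [/GAB[y By Gxy]|nAx] := pselect (A x); first by exists y.
  by exists point.
apply/card_le_funP; exists f => [x /fP[]//|x y /fP[_ Gx] /fP[_ Gy] fxy].
by rewrite fxy in Gx; apply: Ginj Gx Gy.
Qed.

(** Zorn's lemma on graphs of partial injections from [A] to [B]: if a maximal graph missed both
    some [a] in [A] and some [b] in [B], the pair [(a, b)] could be added to it. *)
Lemma card_le_total (T U : pointedType) (A : set T) (B : set U) :
  A #<= B \/ B #<= A.
Proof.
pose P (G : set (T * U)) := [/\ G `<=` A `*` B,
  forall x x' y, G (x, y) -> G (x', y) -> x = x' &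
  forall x y y', G (x, y) -> G (x, y') -> y = y'].
have [F FP totF|G [[GAB Gl Gr] Gmax]] := @Zorn_bigcup _ P.
  have two p q : (\bigcup_(X in F) X) p -> (\bigcup_(X in F) X) q ->
      exists X, [/\ P X, X p & X q].
    move=> [X FX Xp] [Y FY Yq].
    have [XY|YX] := totF _ _ FX FY.
      by exists Y; split=> //; [exact: FP|exact: XY].
    by exists X; split=> //; [exact: FP|exact: YX].
  split=> [p [X /FP[XAB _ _] /XAB //]|x x' y|x y y'] Fp Fq.
    by have [X [[_ Xl _] Xp Xq]] := two _ _ Fp Fq; apply: Xl Xp Xq.
  by have [X [[_ _ Xr] Xp Xq]] := two _ _ Fp Fq; apply: Xr Xp Xq.
have [GA|/existsNP[a /not_implyP[Aa Ga]]] :=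
    pselect (forall x, A x -> exists y, G (x, y)).
  left; apply: (@card_le_rel _ _ _ _ (fun x y => G (x, y))) => // x /GA[y Gxy].
  by exists y => //; have [] := GAB _ Gxy.
have [GB|/existsNP[b /not_implyP[Bb Gb]]] :=
    pselect (forall y, B y -> exists x, G (x, y)).
  right; apply: (@card_le_rel _ _ _ _ (fun y x => G (x, y))) => [y /GB[x Gxy]|].
    by exists x => //; have [] := GAB _ Gxy.
  by move=> y y' x; apply: Gr.
exfalso; apply: (Gmax (G `|` [set (a, b)])).
  split; first by move=> p; left.
  by move=> /(_ (a, b) (or_intror erefl)) Gab; apply: Ga; exists b.
split=> [p [/GAB//|->//]|x x' y|x y y'].
  move=> [Gp|[-> ->]] [Gq|[]].
  - exact: Gl Gp Gq.
  - by move=> _ yb; case: Gb; exists x; rewrite -yb.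
  - by case: Gb; exists x'.
  - by move=> ->.
move=> [Gp|[-> ->]] [Gq|[]].
- exact: Gr Gp Gq.
- by move=> xa _; case: Ga; exists y; rewrite -xa.
- by case: Ga; exists y'.
- by move=> ->.
Qed.

(** The two parts of [W], inside and outside [D], are embedded in [D] as pairs tagged by the
    distinct elements [n 0] and [n 1]. So [W] embeds in [D], and its square embeds in that of [D],
    hence in [D]. *)
Lemma card_setXX_absorb (T : pointedType) (D W : set T) :
  infinite_set D -> D `*` D #<= D -> W `\` D #<= D -> W `*` W #<= D.
Proof.
move=> /infiniteP/card_le_funP[n nD nI] /card_le_funP[c cD cI].
move=> /card_le_funP[f fD fI].
have cP a b a1 b1 : D a -> D b -> D a1 -> D b1 -> c (a, b) = c (a1, b1) ->
    a = a1 /\ b = b1.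
  by move=> Da Db Da1 Db1 E; have [-> ->] : (a, b) = (a1, b1) by apply: cI.
pose h x := if pselect (D x) then c (n 0, x) else c (n 1, f x).
have nD' i : D (n i) by apply: nD.
have n01 : n 0 <> n 1 by move/nI => /(_ I I).
have hD x : W x -> D (h x).
  rewrite /h => Wx; case: pselect => Dx; apply: cD; split=> //=.
  exact: fD.
have hI x y : W x -> W y -> h x = h y -> x = y.
  rewrite /h => Wx Wy; case: pselect => Dx; case: pselect => Dy.
  - by case/cP.
  - by case/cP => //; apply: fD.
  - by case/cP => // [|/esym/n01//]; apply: fD.
  - by case/cP => //; [exact: fD..|move=> _; apply: fI].
apply/card_le_funP; exists (fun p => c (h p.1, h p.2)) => [p [? ?]|].
  by apply: cD; split; apply: hD.
move=> [x y] [x' y'] [/= Wx Wy] [/= Wx' Wy'].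
by case/cP; try exact: hD; move=> /hI-> // /hI->.
Qed.

(* Zorn's lemma on partial injections [D `*` D -> D] with [D] infinite: if [D]
   is not already as large as [A], then [A `\` D] contains a copy [E] of [D],
   and the injection extends to [D `|` E] with the new pairs sent into [E]. *)
Theorem card_le_setXX (T : pointedType) (A : set T) :
  infinite_set A -> A `*` A #<= A.
Proof.
move=> Ainf.
pose dom (G : set ((T * T) * T)) := [set d | exists y, G ((d, d), y)].
pose Q (G : set ((T * T) * T)) := [/\ dom G `<=` A, infinite_set (dom G),
  forall p p' y, G (p, y) -> G (p', y) -> p = p',
  forall a b y, G ((a, b), y) -> [/\ dom G a, dom G b & dom G y] &
  forall a b, dom G a -> dom G b -> exists y, G ((a, b), y)].
(* The empty chain has an empty union, whose domain is not infinite; [Q] is therefore demanded of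
   nonempty graphs only. *)
pose P G := G !=set0 -> Q G.
have domS G H : G `<=` H -> dom G `<=` dom H.
  by move=> GH d [y /GH]; exists y.
have [F FP totF [g [X0 FX0 X0g]]|G [PG Gmax]] := @Zorn_bigcup _ P.
  set U := \bigcup_(X in F) X.
  have QF X p : F X -> X p -> Q X by move=> FX Xp; apply: FP => //; exists p.
  have subU X : F X -> X `<=` U by move=> FX; apply: bigcup_sup.
  have two p q : U p -> U q -> exists X, [/\ F X, Q X, X p & X q].
    move=> [X FX Xp] [Y FY Yq].
    have [XY|YX] := totF _ _ FX FY.
      by exists Y; split=> //; [exact: QF FY Yq|exact: XY].
    by exists X; split=> //; [exact: QF FX Xp|exact: YX].
  split.
  - move=> d [y [X FX Xd]]; have [+ _ _ _ _] := QF _ _ FX Xd.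
    by apply; exists y.
  - have [_ X0inf _ _ _] := QF _ _ FX0 X0g.
    by apply: sub_infinite_set X0inf; apply/domS/subU.
  - move=> p p' y Up Up'; have [X [_ [_ _ + _ _] Xp Xp']] := two _ _ Up Up'.
    by apply; [exact: Xp|exact: Xp'].
  - move=> a b y [X FX Xab]; have [_ _ _ /(_ _ _ _ Xab)[Xa Xb Xy] _] :=
      QF _ _ FX Xab.
    by split; apply: domS (subU _ FX) _ _.
  - move=> a b [y Ua] [z Ub].
    have [X [FX [_ _ _ _ Xab] Xa Xb]] := two _ _ Ua Ub.
    have [||t Xt] := Xab a b; [by exists y|by exists z|].
    by exists t; apply: subU Xt.
(* The empty graph satisfies [P] vacuously but is not maximal: a countable subset of [A] carries the
   graph [H] of a pairing function on the natural numbers. *)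
have [G0|/set0P/PG[GA Ginf Ginj Gdom Gex]] := eqVneq G set0.
  have /infiniteP/card_le_funP[n nA nI] := Ainf.
  pose H := [set q | exists i j,
    q = ((n i, n j), n (pickle (i, j)))] : set ((T * T) * T).
  have Hn i : dom H (n i) by exists (n (pickle (i, i))), i, i.
  exfalso; apply: (Gmax H).
    rewrite G0; split=> [//|H0].
    by have /= := H0 ((n 0, n 0), n (pickle (0, 0))); apply; exists 0, 0.
  move=> _; split.
  - by move=> d [y [i [j [-> _ _]]]]; apply: nA.
  - apply/infiniteP/card_le_funP; exists n => // i j _ _; exact: nI.
  - move=> p p' y [i [j [-> ->]]] [i' [j' [-> /nI]]].
    by move=> /(_ I I)/(pcan_inj pickleK)[-> ->].
  - by move=> a b y [i [j [-> -> ->]]].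
  - move=> a b [y [i [j [-> _ _]]]] [z [i' [j' [-> _ _]]]].
    by exists (n (pickle (i, i'))), i, i'.
set D := dom G in GA Ginf Gdom Gex.
have DD : D `*` D #<= D.
  apply: (@card_le_rel _ _ _ _ (fun p y => G (p, y))) => [[a b] [/= Da Db]|//].
  have [y Gy] := Gex _ _ Da Db; exists y => //; by have [] := Gdom _ _ _ Gy.
have [AD|/card_le_funP[e eAD eI]] := card_le_total (A `\` D) D.
  by apply: card_le_trans (card_setXX_absorb Ginf DD AD) (subset_card_le GA).
pose W := D `|` e @` D.
have /card_le_funP[c cD cI] : W `*` W #<= D.
  apply: card_setXX_absorb => //.
  apply: card_le_trans (card_image_le e D); apply: subset_card_le.
  by move=> x [[//|]].
(* [c] codes the new pairs in [D], and [e] moves the codes out of [D], so that they cannot collide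
   with the values of [G], which all lie in [D]. *)
pose H := G `|` [set q | [/\ W q.1.1, W q.1.2, ~ (D q.1.1 /\ D q.1.2) &
  q.2 = e (c q.1)]].
have eD x : D x -> ~ D (e x) by case/eAD.
have domH : dom H = W.
  apply/seteqP; split=> [d [y [Gd|[]//]]|d Wd]; first by left; exists y.
  have [[y Gd]|nDd] := pselect (D d); first by exists y; left.
  by exists (e (c (d, d))); right; split=> //= -[].
exfalso; apply: (Gmax H).
  split=> [q Gq|HG]; first by left.
  have /infinite_setN0[d Dd] := Ginf.
  apply: (eD d Dd); apply: (domS _ _ HG); rewrite domH; right; by exists d.
move=> _; rewrite /Q domH; split.
- move=> d [/GA//|[x Dx <-]]; by case: (eAD _ Dx).
- by apply: sub_infinite_set Ginf => d; left.
- move=> p p' y [Gp|[/= Wp1 Wp2 _ yp]] [Gp'|[/= Wp'1 Wp'2 _ yp']].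
  + exact: Ginj Gp Gp'.
  + have Dc : D (c p') by apply: cD.
    by case: p Gp => a b /Gdom[_ _]; rewrite yp' => /(eD _ Dc).
  + have Dc : D (c p) by apply: cD.
    by case: p' Gp' => a b /Gdom[_ _]; rewrite yp => /(eD _ Dc).
  + apply: cI; [by []|by []|apply: eI; [exact: cD|exact: cD|]].
    by rewrite -yp -yp'.
- move=> a b y [/Gdom[Da Db Dy]|[/= Wa Wb _ ->]]; first by split; left.
  by split=> //; right; exists (c (a, b)) => //; apply: cD.
- move=> a b Wa Wb.
  have [[Da Db]|nD] := pselect (D a /\ D b).
    by have [y Gy] := Gex _ _ Da Db; exists y; left.
  by exists (e (c (a, b))); right.
Qed.

Local Open Scope ring_scope.
Local Open Scope card_scope.

(** * Adjoining a unit to the algebra *)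

Section Unitization.
Variables (K : numFieldType) (X : topologicalLmodType K) (mul : X -> X -> X).

(* [X] has no unit, so [peval] is not directly a ring morphism; after adjoining
   a unit it becomes the second component of the morphism [mmap]
   (lemma [ueval_pair]). *)
Definition unitization of comm_top_algebra mul : Type := (K * X)%type.

Hypothesis mulP : comm_top_algebra mul.
Local Notation U := (unitization mulP).
HB.instance Definition _ := GRing.Zmodule.copy U (K * X)%type.

Let mulxA x y z : mul x (mul y z) = mul (mul x y) z.
Proof. by case: mulP. Qed.
Let mulxC x y : mul x y = mul y x.
Proof. by case: mulP. Qed.
Let mulxDl x y z : mul (x + y) z = mul x z + mul y z.
Proof. by case: mulP. Qed.
Let mulxZl a x y : mul (a *: x) y = a *: mul x y.
Proof. by case: mulP. Qed.

(** A pair stands for the formal sum of a scalar and an element of [X]; the product is expanded by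
    distributivity. *)
Definition umul (u v : U) : U :=
  (u.1 * v.1, u.1 *: v.2 + v.1 *: u.2 + mul u.2 v.2).

Definition uone : U := (1, 0).

Let mul0x x : mul 0 x = 0.
Proof. by rewrite -(scale0r (0 : X)) mulxZl !scale0r. Qed.

Lemma umulA : associative umul.
Proof.
move=> [a x] [b y] [c z]; congr pair => /=; first by rewrite mulrA.
rewrite !scalerDr !mulxDl ![mul x (_ + _)]mulxC !mulxDl !mulxZl !scalerA.
rewrite (mulxC z x) (mulxC y x) (mulxC (mul y z)) mulxA (mulrC c a) (mulrC c b).
rewrite -!addrA; do 2!congr (_ + _); rewrite addrCA; congr (_ + _).
by rewrite [RHS]addrCA; congr (_ + _); rewrite addrCA.
Qed.

Lemma umulC : commutative umul.
Proof.
by move=> [a x] [b y]; congr pair => /=; rewrite 1?mulrC // mulxC [_ *: y + _]addrC.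
Qed.

Lemma umul1 : left_id uone umul.
Proof.
by move=> [a x]; congr pair => /=; rewrite ?mul1r // scale1r scaler0 mul0x !addr0.
Qed.

Lemma umulDl : left_distributive umul +%R.
Proof.
move=> [a x] [b y] [c z]; congr pair => /=; first by rewrite mulrDl.
by rewrite scalerDl scalerDr mulxDl [RHS]addrACA; congr (_ + _); rewrite addrACA.
Qed.

Lemma uone_neq0 : uone != 0.
Proof. by apply/eqP => -[/eqP]; rewrite oner_eq0. Qed.

HB.instance Definition _ :=
  GRing.Zmodule_isComNzRing.Build U umulA umulC umul1 umulDl uone_neq0.

Definition uscal (a : K) : U := (a, 0).
Definition uemb (x : X) : U := (0, x).

Lemma uscal_zmod : zmod_morphism uscal.
Proof. by move=> a b; congr pair; rewrite subr0. Qed.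
Lemma uscal_monoid : monoid_morphism uscal.
Proof.
by split=> // a b; congr pair => /=; rewrite mul0x !scaler0 !addr0.
Qed.
HB.instance Definition _ := GRing.isZmodMorphism.Build K U uscal uscal_zmod.
HB.instance Definition _ := GRing.isMonoidMorphism.Build K U uscal uscal_monoid.

Lemma uemb_zmod : zmod_morphism uemb.
Proof. by move=> a b; congr pair; rewrite subr0. Qed.
HB.instance Definition _ := GRing.isZmodMorphism.Build X U uemb uemb_zmod.

Lemma uembM x y : uemb x * uemb y = uemb (mul x y).
Proof. by congr pair => /=; rewrite ?mul0r // !scale0r !add0r. Qed.

Lemma uembZ a x : uscal a * uemb x = uemb (a *: x).
Proof. by congr pair => /=; rewrite ?mulr0 // mul0x scale0r !addr0. Qed.

Lemma uemb_nprod s : s != [::] -> \prod_(x <- s) uemb x = uemb (nprod mul s).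
Proof.
case: s => [//|x s] _ /=; rewrite big_cons.
by elim: s x => [|y s IHs] x /=; rewrite ?big_nil ?mulr1 // big_cons mulrA uembM.
Qed.

Lemma uemb_nprod_nseq n x : (0 < n)%N -> uemb (nprod mul (nseq n x)) = uemb x ^+ n.
Proof.
case: n => // n _; rewrite -uemb_nprod // big_nseq.
by rewrite iter_mulr_1.
Qed.

Definition ueval n (x : 'I_n -> X) : {mpoly K[n]} -> U := mmap uscal (uemb \o x).
HB.instance Definition _ n (x : 'I_n -> X) :=
  GRing.RMorphism.copy (ueval x) (mmap uscal (uemb \o x)).

(** The monomial 1 must be excluded: [mono_eval] gives it the default value 0, that of [nprod] on
    the empty list, while [mmap1] gives 1. *)
Lemma mmap1_uemb n (x : 'I_n -> X) (m : 'X_{1..n}) :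
  m != 0%MM -> mmap1 (uemb \o x) m = uemb (mono_eval mul x m).
Proof.
move=> m0; rewrite /mono_eval -uemb_nprod.
  rewrite big_flatten big_map big_enum; apply: eq_bigr => i _ /=.
  by rewrite big_nseq iter_mulr_1 -mnm_tnth.
apply: contra_neq m0 => m0; apply/mnmP => i; rewrite mnm0E.
case mi: (m i) => [//|k].
have : x i \in flatten [seq nseq (tnth m i) (x i) | i <- enum 'I_n].
  by apply/flatten_mapP; exists i; rewrite ?mem_enum // mem_nseq -mnm_tnth mi eqxx.
by rewrite m0.
Qed.

Lemma ueval_pair n (x : 'I_n -> X) (P : {mpoly K[n]}) :
  ueval x P = (P@_0%MM, peval mul P x).
Proof.
(* The constant monomial contributes to the first component only, every other monomial to the second
   only. *)
have term m : uscal P@_m * mmap1 (uemb \o x) m =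
    (P@_m * (m == 0%MM)%:R, P@_m *: mono_eval mul x m).
  have [->|m0] := eqVneq m 0%MM; last first.
    by rewrite mmap1_uemb // uembZ mulr0.
  rewrite mmap11 !mulr1 /mono_eval; congr pair.
  rewrite (_ : flatten _ = [::]) ?scaler0 //.
  by elim: (enum _) => // i e IHe; rewrite map_cons -mnm_tnth mnm0E.
rewrite /ueval /mmap (eq_bigr _ (fun m _ => term m)).
have -> (s : seq 'X_{1..n}) : \sum_(m <- s)
    ((P@_m * (m == 0%MM)%:R, P@_m *: mono_eval mul x m) : U) =
    (\sum_(m <- s) P@_m * (m == 0%MM)%:R,
     \sum_(m <- s) P@_m *: mono_eval mul x m).
  by elim: s => [|m s IHs]; rewrite ?big_nil // !big_cons IHs.
congr pair; rewrite [in RHS](mpolyE P) raddf_sum /=.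
by apply: eq_bigr => m _; rewrite mcoeffZ mcoeffX.
Qed.
End Unitization.

(** * Substitution in polynomials, and leading monomials *)

Section Substitution.
Variable K : fieldType.

Definition msubst n m (G : 'I_n -> {mpoly K[m]}) : {mpoly K[n]} -> {mpoly K[m]} :=
  mmap (@mpolyC m K) G.

Definition mrename n m (s : 'I_n -> 'I_m) : {mpoly K[n]} -> {mpoly K[m]} :=
  msubst (fun i => 'X_(s i)).

(** Identifying variables keeps the degree of each monomial; the total degree can drop, by
    cancellation, but not grow. *)
Lemma msize_mrename n m (s : 'I_n -> 'I_m) P : (msize (mrename s P) <= msize P)%N.
Proof.
rewrite /mrename /msubst /mmap big_seq.
elim/big_ind: _ => [|p q lp lq|k kP]; first by rewrite msize0.
  by apply: leq_trans (msizeD_le _ _) _; rewrite geq_max lp.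
rewrite mul_mpolyC; apply: leq_trans (msizeZ_le _ _) _.
rewrite /mmap1 mprodXnE msizeX mdeg_sum.
apply: leq_trans (msize_mdeg_lt kP); rewrite ltnS mdegE leq_sum // => i _.
by rewrite mdegMn mdeg1 mul1n.
Qed.

(** The monomial with exponents [k] is sent to a polynomial with leading monomial [phi k]. As [phi]
    is injective, these leading monomials are distinct and the largest one survives in the sum. *)
Lemma msubst_neq0 n m (G : 'I_n -> {mpoly K[m]}) (s : 'I_n -> 'I_m) (N : 'I_n -> nat)
    (P : {mpoly K[n]}) :
  (forall i, mlead (G i) = (U_(s i) *+ N i)%MM) -> (forall i, (0 < N i)%N) ->
  injective s -> P@_0%MM = 0 -> P <> 0 -> msubst G P <> 0.
Proof.
move=> GN N0 sI P0 /eqP PN0 SP0.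
have GN0 i : G i != 0.
  apply: contra_eq_neq (GN i) => ->; rewrite mlead0; apply/eqP => /mnmP/(_ (s i)).
  by rewrite mnm0E mulmnE mnm1E eqxx mul1n => /esym; apply/eqP; rewrite -lt0n.
pose phi (k : 'X_{1..n}) : 'X_{1..m} := (\sum_i U_(s i) *+ N i *+ k i)%MM.
have phiE k i : phi k (s i) = (N i * k i)%N.
  rewrite mnm_sumE (bigD1 i) //= !mulmnE mnm1E eqxx mul1n big1 ?addn0 // => j ji.
  by rewrite !mulmnE mnm1E (inj_eq sI) (negPf ji).
have phiI : injective phi.
  move=> k l kl; apply/mnmP => i; apply/eqP; rewrite -(eqn_pmul2l (N0 i)).
  by rewrite -!phiE kl.
have leadG k : mlead (mmap1 G k) = phi k.
  rewrite /mmap1 mlead_prod => [|i _ _]; last by rewrite expf_neq0.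
  by apply: eq_bigr => i _; rewrite mleadX // GN.
have leadT k : k \in msupp P -> mlead ((P@_k)%:MP * mmap1 G k) = phi k.
  by rewrite mcoeff_msupp => Pk; rewrite mul_mpolyC mleadZ.
have /esym : mlead (msubst G P) = (\join_(k <- msupp P) phi k)%O.
  rewrite /msubst /mmap [in RHS]big_seq [in LHS]big_seq mlead_sum.
    by apply: eq_bigr => k /leadT.
  rewrite (_ : map _ _ = map phi [seq k <- msupp P | k \in msupp P]).
    by rewrite map_inj_uniq // filter_uniq.
  by apply/eq_in_map => k; rewrite mem_filter => /andP[/leadT].
(* If the image were 0, the join of all [phi k] would be the least monomial 1. Each [k] in the
   support would then be 0, leaving only the constant term of [P], which vanishes. *)
rewrite SP0 mlead0 => join0.
have supp0 k : k \in msupp P -> k = 0%MM.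
  move=> kP; apply: phiI; rewrite [RHS](_ : _ = 0%MM); last first.
    by rewrite /phi big1 // => i _; rewrite mnm0E mulm0n.
  apply/eqP; rewrite -lex0 -[X in (_ <= X)%O]join0.
  by have := @joins_sup_seq _ _ _ (msupp P) xpredT phi k kP isT.
have := mlead_supp PN0; move/supp0 => lead0.
by move: PN0; rewrite -mleadc_eq0 lead0 P0 eqxx.
Qed.

(** For nonzero [Q], [msize] is the degree plus one, so [Q] has degree below [N]; the monomial order
    compares degrees first. *)
Lemma mlead_perturb m (Q : {mpoly K[m]}) (a : K) (j : 'I_m) N :
  (msize Q <= N)%N -> (0 < N)%N -> a != 0 ->
  mlead (Q + a *: 'X_j ^+ N) = (U_(j) *+ N)%MM.
Proof.
move=> QN N0 a0; have lX : mlead (a *: 'X_j ^+ N : {mpoly K[m]}) = (U_(j) *+ N)%MM.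
  by rewrite mleadZ // mpolyXn mleadXm.
rewrite mleadDr lX // lt_mdeg_ltmc // mdegMn mdeg1 mul1n.
have [->|Q0] := eqVneq Q 0; first by rewrite mlead0 mdeg0.
by rewrite -mlead_deg // in QN.
Qed.

End Substitution.

(** * Evaluation of polynomials without constant term *)

Section Evaluation.
Variables (K : numFieldType) (X : topologicalLmodType K) (mul : X -> X -> X).
Hypothesis mulP : comm_top_algebra mul.

(** Without constant term, the value of [G i] in the unitization is the embedding of an element of
    [X], at which [P] can be evaluated in turn. *)
Lemma ueval_msubst n m (G : 'I_n -> {mpoly K[m]}) (x : 'I_m -> X) P :
  (forall i, no_const_term (G i)) ->
  ueval mulP x (msubst G P) = ueval mulP (fun i => peval mul (G i) x) P.
Proof.
move=> G0; rewrite /msubst {1}/mmap raddf_sum; apply: eq_bigr => k _ /=.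
rewrite rmorphM /=; congr (_ * _); first by rewrite [LHS]mmapC.
rewrite rmorph_prod; apply: eq_bigr => i _; rewrite rmorphXn; congr (_ ^+ _).
by rewrite /= ueval_pair (G0 i).
Qed.

Lemma peval_msubst n m (G : 'I_n -> {mpoly K[m]}) (x : 'I_m -> X) P :
  (forall i, no_const_term (G i)) ->
  peval mul (msubst G P) x = peval mul P (fun i => peval mul (G i) x).
Proof. by move=> G0; have := ueval_msubst x P G0; rewrite !ueval_pair => -[]. Qed.

(** The constant term is the first component of [ueval] at any point, so [ueval_msubst] at the point
    0 suffices. *)
Lemma no_const_msubst n m (G : 'I_n -> {mpoly K[m]}) P :
  (forall i, no_const_term (G i)) -> no_const_term P ->
  no_const_term (msubst G P).
Proof.
move=> G0 P0; have := ueval_msubst (fun=> 0) P G0.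
by rewrite !ueval_pair P0 => -[].
Qed.

Lemma pevalD n (x : 'I_n -> X) P Q :
  peval mul (P + Q) x = peval mul P x + peval mul Q x.
Proof. by have := raddfD (ueval mulP x) P Q => /=; rewrite !ueval_pair => -[]. Qed.

Lemma pevalB n (x : 'I_n -> X) P Q :
  peval mul (P - Q) x = peval mul P x - peval mul Q x.
Proof. by have := raddfB (ueval mulP x) P Q => /=; rewrite !ueval_pair => -[]. Qed.

Lemma peval0 n (x : 'I_n -> X) : peval mul 0 x = 0.
Proof. by have := raddf0 (ueval mulP x) => /=; rewrite !ueval_pair => -[]. Qed.

Lemma pevalZ n (x : 'I_n -> X) (a : K) P : peval mul (a *: P) x = a *: peval mul P x.
Proof.
have : ueval mulP x (a *: P) = uscal mulP a * ueval mulP x P by exact: mmapZ.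
rewrite !ueval_pair => -[_ ->]; have [_ mulC _ mulZ _] := mulP.
by rewrite mulC -[X in mul _ X](scale0r (0 : X)) mulC mulZ scaler0 scale0r !addr0.
Qed.

Lemma pevalM n (x : 'I_n -> X) P Q : no_const_term P -> no_const_term Q ->
  peval mul (P * Q) x = mul (peval mul P x) (peval mul Q x).
Proof.
move=> P0 Q0; have := rmorphM (ueval mulP x) P Q => /=; rewrite !ueval_pair P0 Q0.
by rewrite uembM => -[].
Qed.

Lemma pevalX n (x : 'I_n -> X) i : peval mul ('X_i : {mpoly K[n]}) x = x i.
Proof.
have : ueval mulP x 'X_i = uemb mulP (x i) by rewrite /ueval mmapX mmap1U.
by rewrite ueval_pair => -[].
Qed.

Lemma pevalXn n (x : 'I_n -> X) i N : (0 < N)%N ->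
  peval mul ('X_i ^+ N : {mpoly K[n]}) x = nprod mul (nseq N (x i)).
Proof.
move=> N0; have : ueval mulP x ('X_i ^+ N) = uemb mulP (x i) ^+ N.
  by rewrite rmorphXn /= /ueval mmapX mmap1U.
by rewrite -uemb_nprod_nseq // ueval_pair => -[].
Qed.

Lemma no_const_X n (i : 'I_n) : no_const_term ('X_i : {mpoly K[n]}).
Proof. by rewrite /no_const_term mcoeffX mnm1_eq0. Qed.

Lemma no_const_mrename n m (s : 'I_n -> 'I_m) (P : {mpoly K[n]}) :
  no_const_term P -> no_const_term (mrename s P).
Proof. by apply: no_const_msubst => i; exact: no_const_X. Qed.

Lemma eq_peval n (x y : 'I_n -> X) P : x =1 y -> peval mul P x = peval mul P y.
Proof. by move/funext->. Qed.

Lemma peval_mrename n m (s : 'I_n -> 'I_m) (x : 'I_m -> X) P :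
  peval mul (mrename s P) x = peval mul P (x \o s).
Proof.
rewrite peval_msubst => [|i]; last exact: no_const_X.
by apply: eq_peval => i; rewrite pevalX.
Qed.

Lemma peval_cst0 n (P : {mpoly K[n]}) : peval mul P (fun=> 0) = 0.
Proof.
have [_ _ _ mulZ _] := mulP.
rewrite /peval big1 // => m _; rewrite (_ : mono_eval _ _ _ = 0) ?scaler0 //.
rewrite /mono_eval; set s := flatten _.
have : all (pred1 0) s.
  apply/allP => y /flatten_mapP[i _].
  by rewrite mem_nseq => /andP[_ /eqP->] /=.
case: s => //= y s /andP[/eqP-> _]; elim: s => //= z s IHs.
by rewrite -{1}(scale0r (0 : X)) mulZ scale0r.
Qed.

End Evaluation.

(** * Generated subalgebras and independence of perturbed elements *)

Section Generation.
Variables (K : numFieldType) (X : topologicalLmodType K) (mul : X -> X -> X).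
Hypothesis mulP : comm_top_algebra mul.

(** Renames the variables by positions in the duplicate-free list, merging those with equal values.
    This yields the pairwise distinct arguments that [SFG] requires, without raising the degree. *)
Lemma peval_over_seq n (x : 'I_n -> X) (P : {mpoly K[n]}) (s : seq X) :
  no_const_term P -> (forall i, x i \in s) ->
  exists Q : {mpoly K[size (undup s)]}, [/\ no_const_term Q,
    (msize Q <= msize P)%N &
    peval mul Q (tnth (in_tuple (undup s))) = peval mul P x].
Proof.
move=> P0 xs; have /choice[f fP] i : exists j, x i = tnth (in_tuple (undup s)) j.
  by apply/tnthP; rewrite /= mem_undup.
exists (mrename f P); split; first exact: (no_const_mrename mulP).
  exact: msize_mrename.
by rewrite (peval_mrename mulP); apply: eq_peval => i /=.
Qed.

Lemma tnth_undup_inj (s : seq X) : injective (tnth (in_tuple (undup s))).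
Proof.
move=> i j; rewrite !(tnth_nth 0) /= => /eqP.
by rewrite nth_uniq ?undup_uniq // => /eqP/val_inj.
Qed.

(** The polynomial values at points of [S], repetitions allowed, form a subalgebra [T] containing
    [S]; repetitions are removed only at the end. *)
Lemma gen_subalgP (S : set X) y : gen_subalg mul S y ->
  exists n (P : {mpoly K[n]}) (x : 'I_n -> X),
    [/\ no_const_term P, injective x, forall i, S (x i) & y = peval mul P x].
Proof.
pose T := [set y | exists n (P : {mpoly K[n]}) (x : 'I_n -> X),
    [/\ no_const_term P, forall i, S (x i) & y = peval mul P x]].
(* Sum and product are treated alike: both polynomials are moved to disjoint blocks of [n + m]
   variables and combined there. *)
have joint (F : forall n, {mpoly K[n]} -> {mpoly K[n]} -> {mpoly K[n]})
    (op : X -> X -> X) :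
    (forall n (P Q : {mpoly K[n]}) x, no_const_term P -> no_const_term Q ->
      no_const_term (F n P Q) /\
      peval mul (F n P Q) x = op (peval mul P x) (peval mul Q x)) ->
    forall y z, T y -> T z -> T (op y z).
  move=> Fop _ _ [n [P [x [P0 xS ->]]]] [m [Q [x' [Q0 xS' ->]]]].
  pose w (i : 'I_(n + m)) := match fintype.split i with inl j => x j | inr j => x' j end.
  pose P' := mrename (@lshift n m) P; pose Q' := mrename (@rshift n m) Q.
  have [|| F0 Fe] := Fop _ P' Q' w; try exact: (no_const_mrename mulP).
  exists (n + m)%N, (F _ P' Q'), w; split=> // [i|].
    by rewrite /w; case: (fintype.split i).
  rewrite Fe !(peval_mrename mulP); congr op; apply: eq_peval => i /=.
    by rewrite /w (unsplitK (inl i)).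
  by rewrite /w (unsplitK (inr i)).
have subT : subalgebra mul T.
  split.
  - exists 0%N, 0, (fun=> 0); split=> [|[]//|]; first exact: mcoeff0.
    by rewrite (peval0 mulP).
  - apply: (joint (fun n P Q => P + Q)) => n P Q x P0 Q0; split.
      by rewrite /no_const_term mcoeffD P0 Q0 addr0.
    exact: pevalD.
  - move=> a _ [n [P [x [P0 xS ->]]]]; exists n, (a *: P), x; split=> //.
      by rewrite /no_const_term mcoeffZ P0 mulr0.
    by rewrite (pevalZ mulP).
  - apply: (joint (fun n P Q => P * Q)) => n P Q x P0 Q0; split.
      by rewrite /no_const_term rmorphM /= P0 mul0r.
    exact: pevalM.
move=> /(_ T) [].
  split=> // z Sz; exists 1%N, 'X_ord0, (fun=> z); split=> //.
    exact: no_const_X.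
  by rewrite (pevalX mulP).
move=> n [P [x [P0 xS ->]]].
have [i|Q [Q0 _ Qe]] := @peval_over_seq _ x P (codom x) P0.
  exact: codom_f.
exists (size (undup (codom x))), Q, (tnth (in_tuple (undup (codom x)))).
split=> //; first exact: tnth_undup_inj.
move=> i; have := mem_tnth i (in_tuple (undup (codom x))).
by rewrite /= mem_undup => /codomP[j ->].
Qed.

(** A common value of [P] at [x] and [Q] at [y] is a relation between distinct free generators, so
    the difference of [P] and [Q] in separate variables is the zero polynomial. *)
Lemma gen_subalg_disjoint (S S1 S2 : set X) : SFG mul S ->
  S1 `<=` S -> S2 `<=` S -> S1 `&` S2 = set0 ->
  gen_subalg mul S1 `&` gen_subalg mul S2 = [set 0].
Proof.
move=> SS S1S S2S S12; apply/seteqP; split=> [z []|_ ->]; last first.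
  by split=> T [[]].
move=> /gen_subalgP[n [P [x [P0 xI xS ->]]]].
move=> /gen_subalgP[m [Q [y [Q0 yI yS PQ]]]].
pose w (i : 'I_(n + m)) := match fintype.split i with inl j => x j | inr j => y j end.
have [R0|/eqP RN0] := eqVneq (mrename (@lshift n m) P - mrename (@rshift n m) Q) 0.
  (* Evaluating the zero polynomial with the second block set to 0 leaves the value of [P] at [x],
     which is thus 0. *)
  pose v (i : 'I_(n + m)) := if fintype.split i is inl j then x j else 0.
  have /esym := congr1 (fun p => peval mul p v) R0.
  rewrite (pevalB mulP) (peval0 mulP) !(peval_mrename mulP).
  rewrite (@eq_peval _ _ _ _ _ x) => [|i]; last by rewrite /v /= (unsplitK (inl i)).
  rewrite (@eq_peval _ _ _ m _ (fun=> 0)) => [|i]; last first.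
    by rewrite /v /= (unsplitK (inr i)).
  by rewrite (peval_cst0 mulP) subr0.
exfalso; apply: (SS _ _ w _ RN0).
- by rewrite /no_const_term mcoeffB !(no_const_mrename mulP) // subrr.
- have xy i j : x i <> y j.
    move=> xyij; have : (S1 `&` S2) (x i) by split=> //; rewrite xyij.
    by rewrite S12.
  move=> i j; rewrite -(splitK i) -(splitK j) /w !unsplitK.
  case: (fintype.split i) => i'; case: (fintype.split j) => j' /=; try by move/xI->.
  + by move/xy.
  + by move/esym/xy.
  + by move/yI->.
- by move=> i; rewrite /w; case: (fintype.split i) => j; [exact: S1S|exact: S2S].
rewrite (pevalB mulP) !(peval_mrename mulP).
rewrite (@eq_peval _ _ _ _ _ x) => [|i]; last by rewrite /w /= (unsplitK (inl i)).
rewrite (@eq_peval _ _ _ _ _ y) => [|i]; last by rewrite /w /= (unsplitK (inr i)).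
by rewrite -PQ subrr.
Qed.

(* Once everything is written in finitely many elements of [A], the element
   [v i + a i *: c i ^+ N i] has leading monomial [c i ^+ N i]; distinct
   monomials in these elements thus have distinct leading monomials. *)
Lemma perturb_independent (A : set X) (I : Type) (D : set I) (v c : I -> X)
    (N : I -> nat) (a : I -> K) :
  SFG mul A ->
  (forall i, D i -> A (c i)) ->
  (forall i j, D i -> D j -> c i = c j -> i = j) ->
  (forall i, (0 < N i)%N) -> (forall i, a i != 0) ->
  (forall i, exists n (P : {mpoly K[n]}) (x : 'I_n -> X),
    [/\ no_const_term P, (msize P <= N i)%N, forall j, A (x j) &
        v i = peval mul P x]) ->
  forall n (P : {mpoly K[n]}) (q : 'I_n -> I),
    no_const_term P -> P <> 0 -> injective q -> (forall i, D (q i)) ->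
    peval mul P (fun i => v (q i) + a (q i) *: nprod mul (nseq (N (q i)) (c (q i))))
      <> 0.
Proof.
move=> AS cA cI N0 a0 vP n P q P0 PN0 qI qD.
(* Each [v (q i)] is expressible over every list extending its own generators, so that all of them
   can share the list [S] below, which also contains the [c (q i)]. *)
have /choice[s sP] (i : 'I_n) : exists s : seq X, (forall z, z \in s -> A z) /\
    forall s', {subset s <= s'} -> exists Q : {mpoly K[size (undup s')]},
    [/\ no_const_term Q, (msize Q <= N (q i))%N &
       v (q i) = peval mul Q (tnth (in_tuple (undup s')))].
  have [k [R [x [R0 RN xA ->]]]] := vP (q i).
  exists (codom x); split=> [z /codomP[j ->]//|s' ss'].
  have [j|Q [Q0 QR Qe]] := @peval_over_seq _ x R s' R0.
    by apply/ss'/codom_f.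
  by exists Q; split=> //; apply: leq_trans RN.
pose S := codom (c \o q) ++ flatten (codom s).
pose z := tnth (in_tuple (undup S)).
have SA y : y \in S -> A y.
  rewrite mem_cat => /orP[/codomP[i ->]|/flattenP[t /codomP[i ->]]].
    exact: cA.
  by have [+ _] := sP i; apply.
have /choice[Q QP] i : exists Q : {mpoly K[size (undup S)]},
    [/\ no_const_term Q, (msize Q <= N (q i))%N & v (q i) = peval mul Q z].
  have [_] := sP i; apply=> y ys; rewrite mem_cat; apply/orP; right.
  by apply/flattenP; exists (s i) => //; exact: codom_f.
have /choice[f fP] i : exists j, c (q i) = z j.
  apply/tnthP; rewrite /= mem_undup mem_cat; apply/orP; left.
  exact: (codom_f (c \o q)).
pose G i := Q i + a (q i) *: 'X_(f i) ^+ N (q i).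
have G0 i : no_const_term (G i).
  have [Qi0 _ _] := QP i; rewrite /no_const_term mcoeffD Qi0 mcoeffZ add0r.
  rewrite mpolyXn mcoeffX; case: eqP => [/mnmP/(_ (f i))|_]; last exact: mulr0.
  by rewrite mulmnE mnm1E eqxx mul1n mnm0E => N00; have := N0 (q i); rewrite N00.
rewrite (@eq_peval _ _ _ _ _ (fun i => peval mul (G i) z)) => [|i]; last first.
  by rewrite (pevalD mulP) (pevalZ mulP) (pevalXn mulP) // -fP; case: (QP i) => _ _ <-.
rewrite -(peval_msubst mulP) //; apply: AS.
- exact: (no_const_msubst mulP).
- apply: (@msubst_neq0 _ _ _ G f (N \o q)) => // [i|i|]; last 1 first.
  + move=> i j /(congr1 z); rewrite -!fP => /cI eqij.
    by apply: qI; apply: eqij.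
  + by apply: mlead_perturb; rewrite ?a0 ?N0 //; case: (QP i).
  + exact: N0.
- exact: tnth_undup_inj.
- by move=> i; apply: SA; rewrite -mem_undup; apply: (mem_tnth i (in_tuple _)).
Qed.

End Generation.

(** * Small perturbations inside open sets, and construction of the family *)

Lemma open_perturb (K : numFieldType) (X : topologicalLmodType K) (V : set X)
    (x c : X) : open V -> V x -> exists2 a : K, a != 0 & V (x + a *: c).
Proof.
move=> Vo Vx.
have cont : continuous (fun a : K => x + a *: c).
  have cZ : continuous (fun a : K => a *: c).
    move=> a; apply: (@continuous_comp _ _ _ (fun a : K => (a, c))
      (fun z : K * X => z.1 *: z.2)); last exact: scale_continuous.
    by apply: (@cvg_pair _ _ _ (nbhs a) (nbhs a) (nbhs c)) => /=; [exact: cvg_id|exact: cvg_cst].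
  move=> a; apply: (@continuous_comp _ _ _ (fun a : K => (x, a *: c))
    (fun z : X * X => z.1 + z.2)); last exact: add_continuous.
  by apply: (@cvg_pair _ _ _ (nbhs a) (nbhs x) (nbhs (a *: c))) => /=;
    [exact: cvg_cst|exact: cZ].
(* At [a = 0] the map takes the value [x], so it sends a ball around 0 into [V]; [e / 2] is a
   nonzero point of that ball. *)
have /cont : nbhs (x + (0 : K) *: c) V.
  by rewrite scale0r addr0; exact: open_nbhs_nbhs.
move=> /nbhs_ballP[e /= e0 eV]; exists (e / 2).
  by rewrite gt_eqF // divr_gt0.
apply: eV; rewrite /ball /= sub0r normrN gtr0_norm ?divr_gt0 //.
by rewrite ltr_pdivrMr // mulr_natr mulr2n ltrDl.
Qed.

Theorem dense_free_subalgebras (K : numFieldType) (X : topologicalLmodType K)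
    (mul : X -> X -> X) (A : set X) :
  comm_top_algebra mul ->
  SFG mul A ->
  gen_subalg mul A = setT ->
  infinite_set A ->
  (exists B : set (set X), is_base B /\ (B #<= A)) ->
  exists F : X -> set X,
    [/\ forall k, A k ->
          [/\ SFG mul (F k), F k #= A & dense (gen_subalg mul (F k))],
        forall k1 k2, A k1 -> A k2 -> k1 <> k2 -> F k1 `&` F k2 = set0,
        SFG mul (\bigcup_(k in A) F k) &
        forall k1 k2, A k1 -> A k2 -> k1 <> k2 ->
          gen_subalg mul (F k1) `&` gen_subalg mul (F k2) = [set 0]].
Proof.
move=> mulP AS genA Ainf [B [[Bo Bbase] BA]].
pose pX : pointedType := HB.pack (X : Type) (Choice.class X) (isPointed.Build X 0).
have /card_le_funP[c cA cI] := @card_le_setXX pX A Ainf.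
have /pcard_surjP[g gP] : [set V | B V /\ V !=set0] #<= A.
  by apply: card_le_trans BA; apply: subset_card_le => V [].
(* [t] packs the element [v], the exponent and the small scalar. The map [g] covers all nonempty
   basic sets but may take other values, hence the two guards on [g q.2]; where they fail, [setT]
   serves as target. *)
have /choice[d dP] (q : X * X) : exists t : X * nat * K,
    [/\ (0 < t.1.2)%N, t.2 != 0,
      exists n (P : {mpoly K[n]}) (x : 'I_n -> X),
        [/\ no_const_term P, (msize P <= t.1.2)%N, forall j, A (x j) &
            t.1.1 = peval mul P x] &
      open (g q.2) -> g q.2 !=set0 ->
        g q.2 (t.1.1 + t.2 *: nprod mul (nseq t.1.2 (c q)))].
  have [V [Vo [v Vv] VP]] : exists V : set X, [/\ open V, V !=set0 &
      open (g q.2) -> g q.2 !=set0 -> V `<=` g q.2].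
    have [[go g0]|ng] := pselect (open (g q.2) /\ g q.2 !=set0).
      by exists (g q.2); split=> // _ _ y.
    by exists setT; split=> [||go g0]; [exact: openT|exists 0|case: ng].
  have : gen_subalg mul A v by rewrite genA.
  move=> /(gen_subalgP mulP)[n [P [x [P0 _ xA vE]]]].
  have [a a0 Va] := open_perturb (nprod mul (nseq (msize P).+1 (c q))) Vo Vv.
  exists (v, (msize P).+1, a); split=> //=; first by exists n, P, x.
  by move=> go g0; apply: VP.
pose f q := (d q).1.1 + (d q).2 *: nprod mul (nseq (d q).1.2 (c q)).
have indep : forall n (P : {mpoly K[n]}) (q : 'I_n -> X * X),
    no_const_term P -> P <> 0 -> injective q -> (forall i, (A `*` A) (q i)) ->
    peval mul P (f \o q) <> 0.
  by apply: (@perturb_independent _ _ _ mulP A _ _ (fun q => (d q).1.1) c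
    (fun q => (d q).1.2) (fun q => (d q).2)) => // q; case: (dP q).
(* Independence is indexed by pairs, so applied to the difference of two variables it shows that
   distinct pairs give distinct elements. *)
have fI p q : (A `*` A) p -> (A `*` A) q -> f p = f q -> p = q.
  move=> Ap Aq fpq; apply: contrapT => pq.
  pose r (i : 'I_2) := if i == ord0 then p else q.
  apply: (indep 2 ('X_ord0 - 'X_ord_max) r).
  - by rewrite /no_const_term mcoeffB !no_const_X subrr.
  - move=> /(congr1 (fun P => P@_U_(ord0)%MM)); rewrite mcoeffB !mcoeffX mcoeff0.
    rewrite eqxx; case: eqP => [/mnmP/(_ ord0)|_]; first by rewrite !mnm1E.
    by move/eqP; rewrite subr0 oner_eq0.
  - move=> i j; rewrite /r; case: eqP => [->|/eqP i0]; case: eqP => [->|/eqP j0] //.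
    + by move=> /esym.
    + by move=> _; apply/val_inj; case: i j i0 j0 => [[|[]]] //= ? [[|[]]].
  - by move=> i; rewrite /r; case: ifP.
  - by rewrite (pevalB mulP) !(pevalX mulP) /= fpq subrr.
pose F k := [set f (k, a) | a in A].
have FS : SFG mul (\bigcup_(k in A) F k).
  move=> n P x P0 PN0 xI xF.
  have /choice[q qP] i : exists q, (A `*` A) q /\ f q = x i.
    by have [k Ak [a Aa <-]] := xF i; exists (k, a).
  have -> : x = f \o q by apply/funext => i /=; case: (qP i).
  apply: indep => // [i j qij|i]; last by case: (qP i).
  by apply: xI; case: (qP i) => _ <-; case: (qP j) => _ <-; rewrite qij.
have Fsub k : A k -> F k `<=` \bigcup_(k in A) F k by move=> Ak; exact: bigcup_sup.
have Fdisj k1 k2 : A k1 -> A k2 -> k1 <> k2 -> F k1 `&` F k2 = set0.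
  move=> A1 A2 k12; apply/seteqP; split=> // _ [[a Aa <-] [b Ab fba]]; case: k12.
  by have [->] := fI (k2, b) (k1, a) (conj A2 Ab) (conj A1 Aa) fba.
exists F; split=> //; last first.
  by move=> k1 k2 A1 A2 k12; apply: (gen_subalg_disjoint mulP FS) => //;
    [exact: Fsub|exact: Fsub|exact: Fdisj].
move=> k Ak; split.
- move=> n P x P0 PN0 xI xF.
  exact: (FS n P x P0 PN0 xI (fun i => Fsub k Ak _ (xF i))).
- apply: inj_card_eq => a b; rewrite !inE => Aa Ab fab.
  by have [->] := fI (k, a) (k, b) (conj Ak Aa) (conj Ak Ab) fab.
(* Some [a] in [A] codes a basic set [W] inside [V]; for every [k] the generator [f (k, a)] already
   lies in [W]. *)
- move=> V [x Vx] Vo; have [W BW [Wx WV]] := Bbase V Vo x Vx.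
  have [|a Aa gaW] := gP W; first by split=> //; exists x.
  have [_ _ _] := dP (k, a); rewrite /= gaW.
  move=> /(_ (Bo _ BW) (ex_intro _ x Wx)) Wf.
  exists (f (k, a)); split; first exact: WV.
  by move=> T [_]; apply; exists a.
Qed.

Unset Implicit Arguments.

(* K = R (isC = false) or K = C (isC = true).  The index set kappa < alpha of
   the family is represented by the set A itself (which has cardinality alpha). *)
Theorem theorem4p5 (R : realType) (isC : bool)
    (X : topologicalLmodType (Kfield R isC)) (mul : X -> X -> X)
    (A : set X) :
  comm_top_algebra mul ->
  SFG mul A ->
  gen_subalg mul A = setT ->
  infinite_set A ->
  (exists B : set (set X), is_base B /\ (B #<= A)) ->
  exists F : X -> set X,
    [/\ forall k, A k ->
          [/\ SFG mul (F k), F k #= A & dense (gen_subalg mul (F k))],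
        forall k1 k2, A k1 -> A k2 -> k1 <> k2 -> F k1 `&` F k2 = set0,
        SFG mul (\bigcup_(k in A) F k) &
        forall k1 k2, A k1 -> A k2 -> k1 <> k2 ->
          gen_subalg mul (F k1) `&` gen_subalg mul (F k2) = [set 0]].
Proof. exact: dense_free_subalgebras. Qed.
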